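(* Let $F$ be a real Banach space and let $T \ge 1$. Let $\mathcal{K}_0,\mathcal{K}_1,\ldots,\mathcal{K}_T \subseteq F$ be symmetric and convex. For $t=0,\ldots,T$, let $\lambda_{t,1},\ldots,\lambda_{t,m_t}$ be linear functionals on $F$, let $\Lambda_t = [\lambda_{t,1};\ldots;\lambda_{t,m_t}] : F \to \mathbb{R}^{m_t}$, and set $m = m_0+m_1+\cdots+m_T$. If the quantity of interest $Q : F \to \mathbb{R}$ is a linear functional, then a globally optimal recovery map is given by $$\Delta^{\rm opt}: y=[y_0;y_1;\ldots;y_T] \in \mathbb{R}^m \mapsto \sum_{i=1}^{m_0} a^{\rm opt}_{0,i}\, y_{0,i} + \sum_{t=1}^T \sum_{i=1}^{m_t} a^{\rm opt}_{t,i}\, y_{t,i} \in \mathbb{R},$$ where the vector $a^{\rm opt} = [a_0^{\rm opt};a_1^{\rm opt};\ldots;a_T^{\rm opt}] \in \mathbb{R}^m$ is a solution to $$\underset{a=[a_0;a_1;\ldots;a_T] \in \mathbb{R}^m}{\rm minimize} \;\; \sup_{g_0 \in \mathcal{K}_0} \left| \left( Q - \sum_{t=0}^T \sum_{i=1}^{m_t} a_{t,i}\lambda_{t,i} \right)(g_0) \right| + \sum_{s=1}^T \sup_{g_s \in \mathcal{K}_s} \left| \left( \sum_{t=s}^T \sum_{i=1}^{m_t} a_{t,i} \lambda_{t,i} \right)(g_s) \right| .$$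
   Context: An unknown $f_0\in F$ comes with related objects $f_1,\ldots,f_T \in F$, subject to the model assumptions $f_0 \in \mathcal{K}_0$ and $f_{t-1}-f_t \in \mathcal{K}_t$ for $t=1,\ldots,T$, and observed through $y_t = \Lambda_t f_t \in \mathbb{R}^{m_t}$, $t=0,\ldots,T$. A set $\mathcal{K}$ is symmetric if $-g\in\mathcal{K}$ whenever $g \in \mathcal{K}$. A recovery map is an arbitrary (not necessarily linear) map $\Delta:\mathbb{R}^m\to\mathbb{R}$. Its global worst-case error is $${\rm gwce}(\Delta) = \sup\Big\{ \big| Q(f_0) - \Delta([\Lambda_0 f_0;\Lambda_1 f_1;\ldots;\Lambda_T f_T]) \big| : f_0 \in \mathcal{K}_0,\ f_{t-1}-f_t\in\mathcal{K}_t \text{ for } t=1,\ldots,T \Big\}.$$ A recovery map is globally optimal if it minimizes ${\rm gwce}(\Delta)$ over all maps $\Delta:\mathbb{R}^m\to\mathbb{R}$. The notation $[y_0;\ldots;y_T]$ denotes vertical concatenation. *)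

(* Defs.v *)
From mathcomp Require Import all_boot all_order all_algebra.
From mathcomp Require Import all_classical all_reals all_analysis.

Set Implicit Arguments.
Unset Strict Implicit.
Unset Printing Implicit Defensive.

Import Order.TTheory GRing.Theory Num.Theory.
Import numFieldNormedType.Exports.

Local Open Scope classical_set_scope.
Local Open Scope ring_scope.

Definition symmetric_set (V : zmodType) (K : set V) : Prop :=
  forall g, K g -> K (- g).

(* Time steps are indexed by 'I_T.+1, that is by t = 0, ..., T. *)
Definition model_set (V : zmodType) (T : nat) (K : 'I_T.+1 -> set V) :
    set ('I_T.+1 -> V) :=
  [set f | K ord0 (f ord0) /\
    forall s t : 'I_T.+1, t = s.+1 :> nat -> K t (f s - f t)].

(* The space of y = [y_0; ...; y_T], of dimension m_0 + ... + m_T; the block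
   y_t is recovered as [submxcol y t]. *)
Definition data (R : realType) (T : nat) (m : 'I_T.+1 -> nat) : Type :=
  'cV[R]_(\sum_(t < T.+1) m t).

Definition entry (R : realType) (T : nat) (m : 'I_T.+1 -> nat)
    (y : data R m) (t : 'I_T.+1) (i : 'I_(m t)) : R :=
  submxcol y t i ord0.

Definition observe (R : realType) (V : lmodType R) (T : nat)
    (m : 'I_T.+1 -> nat) (lambda : forall t, 'I_(m t) -> {scalar V})
    (f : 'I_T.+1 -> V) : data R m :=
  \mxcol_(t < T.+1) \col_(i < m t) lambda t i (f t).

(* The supremum is taken in the extended reals, so that an infinite worst-case
   error is a legitimate value. *)
Definition gwce (R : realType) (V : lmodType R) (T : nat)
    (K : 'I_T.+1 -> set V) (m : 'I_T.+1 -> nat)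
    (lambda : forall t, 'I_(m t) -> {scalar V}) (Q : {scalar V})
    (Delta : data R m -> R) : \bar R :=
  ereal_sup
    [set (`|Q (f ord0) - Delta (observe lambda f)|)%:E | f in model_set K].

Definition globally_optimal (R : realType) (V : lmodType R) (T : nat)
    (K : 'I_T.+1 -> set V) (m : 'I_T.+1 -> nat)
    (lambda : forall t, 'I_(m t) -> {scalar V}) (Q : {scalar V})
    (Delta : data R m -> R) : Prop :=
  forall Delta' : data R m -> R,
    (gwce K lambda Q Delta <= gwce K lambda Q Delta')%E.

Definition tail_functional (R : realType) (V : lmodType R) (T : nat)
    (m : 'I_T.+1 -> nat) (lambda : forall t, 'I_(m t) -> {scalar V})
    (a : data R m) (s : 'I_T.+1) (g : V) : R :=
  \sum_(t < T.+1 | (s <= t)%N) \sum_(i < m t) entry a i * lambda t i g.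

Definition objective (R : realType) (V : lmodType R) (T : nat)
    (K : 'I_T.+1 -> set V) (m : 'I_T.+1 -> nat)
    (lambda : forall t, 'I_(m t) -> {scalar V}) (Q : {scalar V})
    (a : data R m) : \bar R :=
  (ereal_sup [set (`|Q g - tail_functional lambda a ord0 g|)%:E
                | g in K ord0]
   + \sum_(s < T.+1 | (0 < s)%N)
       ereal_sup [set (`|tail_functional lambda a s g|)%:E | g in K s])%E.

Definition solution (R : realType) (V : lmodType R) (T : nat)
    (K : 'I_T.+1 -> set V) (m : 'I_T.+1 -> nat)
    (lambda : forall t, 'I_(m t) -> {scalar V}) (Q : {scalar V})
    (a : data R m) : Prop :=
  forall b : data R m, (objective K lambda Q a <= objective K lambda Q b)%E.

Definition linear_recovery (R : realType) (T : nat) (m : 'I_T.+1 -> nat)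
    (a y : data R m) : R :=
  \sum_(i < m ord0) entry a i * entry y i
  + \sum_(t < T.+1 | (0 < t)%N) \sum_(i < m t) entry a i * entry y i.

(* Main.v *)
Require Import Defs.
From mathcomp Require Import all_boot all_order all_algebra.
From mathcomp Require Import all_classical all_reals all_analysis.
From mathcomp Require Import ring lra.
Set Implicit Arguments.
Unset Strict Implicit.
Unset Printing Implicit Defensive.
Import Order.TTheory GRing.Theory Num.Theory.
Import numFieldNormedType.Exports.
Local Open Scope classical_set_scope.
Local Open Scope ring_scope.

(** Let N be the null error, the supremum of |Q (f ord0)| over the model members f
whose data vanish.  The theorem follows from the chain of inequalities, valid for
a suitable vector a and arbitrary b and Delta,

  objective a <= N <= gwce Delta  and  gwce (linear_recovery b) <= objective b.

Indeed the first chain used with Delta := linear_recovery b gives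
objective a <= objective b, so a is a solution; and if b is any solution, then
gwce (linear_recovery b) <= objective b <= objective a <= N <= gwce Delta.

- [null_error_le_gwce]: a map Delta cannot distinguish f from - f when both have
  zero data, so it errs by at least |Q (f ord0)| on one of the two.
- [gwce_le_objective]: in the increments g_0 = f_0, g_t = f_(t-1) - f_t, the model
  set becomes the product of the sets K t, and by summation by parts the error of a
  linear recovery becomes a sum of functionals, one for each g_t
  ([error_trajectory]); these are exactly the functionals in the objective.
- [objective_le]: since the g_t vary independently and in symmetric sets, the
  sum of suprema that defines the objective is at most any bound on the error.
- [null_error_attained]: it remains to find a with
  Q (f ord0) - linear_recovery a (observe f) <= N on the whole model set, knowing
  that Q (f ord0) <= N where all the observed functionals vanish.  The entries of a
  are Lagrange multipliers.  They are introduced one constraint at a time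
  ([lagrange_multipliers]), so that only a comparison of slopes on a line is needed
  ([lagrange_multiplier]) and neither topology nor interior points enter.

If some K t is empty, the model set is empty and the objective is -oo
throughout, so every a is a solution, and linear_recovery a is optimal with error -oo;
this case is treated apart. *)

(** * Lagrange multipliers on symmetric convex sets *)

Lemma convex_setP (R : realType) (V : lmodType R) (A : set V) :
  convex_set A <->
  forall (x y : V) (t : R), 0 <= t -> t <= 1 -> A x -> A y ->
    A (t *: x + (1 - t) *: y).
Proof.
split=> [cA x y t t0 t1 Ax Ay | cA x y t /set_mem Ax /set_mem Ay].
  by have /set_mem := cA x y (Itv01 t0 t1) (mem_set Ax) (mem_set Ay).
by apply/mem_set; exact: cA.
Qed.

Lemma scalar_comb (R : realType) (V : lmodType R) (q : V -> R) (t u : R) (x y : V) :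
  scalar q -> q (t *: x + u *: y) = t * q x + u * q y.
Proof.
move=> lq; have q0 : q 0 = 0.
  have /eqP := lq 1 0 0.
  by rewrite scaler0 addr0 mul1r -subr_eq0 opprD addNKr oppr_eq0 => /eqP.
by rewrite lq -[u *: y]addr0 lq q0 addr0.
Qed.

Lemma scalarN (R : realType) (V : lmodType R) (q : V -> R) (x : V) :
  scalar q -> q (- x) = - q x.
Proof.
move=> lq; have := scalar_comb (-1) 0 x 0 lq.
by rewrite scaler0 addr0 mul0r addr0 scaleN1r mulN1r.
Qed.

(** A multiplier c must lie above the slopes (q g - N) / l g where l g > 0, and
below them where l g < 0.  Slopes of the first kind never exceed those of the second
kind, because the segment from g to h meets the kernel of l, where q <= N.  Symmetry of C
provides slopes of the second kind as soon as there are some of the first kind, so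
that the supremum of the latter is finite. *)
Lemma lagrange_multiplier (R : realType) (V : lmodType R) (C : set V)
    (q l : V -> R) (N : R) :
  symmetric_set C -> convex_set C -> scalar q -> scalar l ->
  (forall g, C g -> l g = 0 -> q g <= N) ->
  exists c : R, forall g, C g -> q g - c * l g <= N.
Proof.
move=> symC /convex_setP convC lq ll qN.
have slope g h : C g -> C h -> 0 < l g -> l h < 0 ->
    (q g - N) / l g <= (q h - N) / l h.
  move=> Cg Ch lg lh; have d0 : 0 < l g - l h by lra.
  (* the weight for which l vanishes at the convex combination of g and h *)
  have := convC g h (- l h / (l g - l h)).
  have -> : 1 - - l h / (l g - l h) = l g / (l g - l h) by field; lra.
  move=> Ck; have {Ck} : C (- l h / (l g - l h) *: g + l g / (l g - l h) *: h).
    apply: Ck => //; first by rewrite divr_ge0 //; lra.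
    by rewrite ler_pdivrMr //; lra.
  move/qN; rewrite !scalar_comb // => kN.
  have : - l h / (l g - l h) * q g + l g / (l g - l h) * q h <= N.
    by apply: kN; field; lra.
  rewrite mulrAC [X in _ + X]mulrAC -mulrDl ler_pdivrMr // => kN'.
  rewrite ler_pdivrMr // mulrAC ler_ndivlMr //; lra.
have [[g0 [Cg0 lg0]]|/forallNP noC] := pselect (exists g, C g /\ 0 < l g); last first.
  have l0 g : C g -> l g = 0.
    move=> Cg; have := noC g; have := noC (- g).
    move=> /not_andP[/(_ (symC _ Cg))//|]; rewrite scalarN //.
    by move=> ? /not_andP[//|]; lra.
  by exists 0 => g Cg; rewrite mul0r subr0 qN // l0.
pose L := [set (q g - N) / l g | g in [set g | C g /\ 0 < l g]].
have L0 : L !=set0 by exists ((q g0 - N) / l g0), g0.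
have ubL h : C h -> l h < 0 -> ubound L ((q h - N) / l h).
  by move=> Ch lh _ [g [Cg lg] <-]; exact: slope.
have bL : has_ubound L.
  exists ((q (- g0) - N) / l (- g0)); apply: ubL; first exact: symC.
  by rewrite scalarN //; lra.
exists (sup L) => g Cg; have [lg|lg|lg] := ltgtP (l g) 0.
- have := ge_sup L0 (ubL g Cg lg); rewrite ler_ndivlMr //; lra.
- have : (q g - N) / l g <= sup L by apply: ub_le_sup => //; exists g.
  rewrite ler_pdivrMr //; lra.
- by rewrite lg mulr0 subr0 qN.
Qed.

(** Relaxing the constraint of index i after the others: the induction hypothesis,
used on the intersection of C with the kernel of l i, which is again symmetric and convex,
gives the multipliers in s; then the functional that they correct is bounded by N on
that kernel, so that [lagrange_multiplier] applies to it on C. *)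
Lemma lagrange_multipliers (R : realType) (V : lmodType R) (I : eqType) (s : seq I)
    (C : set V) (q : V -> R) (l : I -> V -> R) (N : R) :
  uniq s -> symmetric_set C -> convex_set C ->
  scalar q -> (forall i, scalar (l i)) ->
  (forall g, C g -> {in s, forall i, l i g = 0} -> q g <= N) ->
  exists c : I -> R, forall g, C g -> q g - \sum_(i <- s) c i * l i g <= N.
Proof.
move=> + + + lq ll; elim: s C => [|i s IH] C /= us symC convC qN.
  by exists (fun=> 0) => g Cg; rewrite big_nil subr0 qN.
case/andP: us => nis us.
pose C' := [set g | C g /\ l i g = 0].
have symC' : symmetric_set C'.
  by move=> g [Cg lg]; split; [exact: symC | rewrite scalarN // lg oppr0].
have convC' : convex_set C'.
  move/convex_setP: convC => convC.
  apply/convex_setP => x y t t0 t1 [Cx lx] [Cy ly]; split; first exact: convC.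
  by rewrite scalar_comb // lx ly !mulr0 addr0.
have [g [Cg lg] lsg|c cN] := IH C' us symC' convC'.
  by apply: qN => // j; rewrite inE => /predU1P[->|/lsg].
have lr : scalar (fun g => q g - \sum_(j <- s) c j * l j g).
  move=> a u v; rewrite lq mulrBr addrACA -opprD mulr_sumr -big_split /=.
  by congr (_ - _); apply: eq_bigr => j _; rewrite ll; ring.
have [|d dN] := @lagrange_multiplier _ _ C _ (l i) N symC convC lr (ll i).
  by move=> g Cg lg; exact: cN.
exists (fun j => if j == i then d else c j) => g Cg.
rewrite big_cons eqxx opprD addrA addrAC.
rewrite (_ : \sum_(j <- s) _ = \sum_(j <- s) c j * l j g); first exact: dN.
by apply: eq_big_seq => j js; case: eqP nis => // <-; rewrite js.
Qed.

(** * Sums of suprema over independent variables *)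

(** The nonemptiness of the sets keeps all suprema away from -oo, which would
absorb +oo in the sum and break the exchange of suprema and sum. *)
Lemma sum_ereal_sup_le (R : realType) (I : finType) (V : Type)
    (A : I -> set V) (u : I -> V -> R) (N : R) :
  (forall i, A i !=set0) ->
  (forall g, (forall i, A i (g i)) -> \sum_i u i (g i) <= N) ->
  (\sum_i ereal_sup [set (u i x)%:E | x in A i] <= N%:E)%E.
Proof.
move=> A0 uN.
(* c stands for the terms whose variables have already been chosen. *)
suff H (s : seq I) (c : R) : uniq s ->
    (forall g, (forall i, A i (g i)) -> c + \sum_(i <- s) u i (g i) <= N) ->
    (c%:E + \sum_(i <- s) ereal_sup [set (u i x)%:E | x in A i] <= N%:E)%E.
  rewrite -[leLHS]add0e; apply: H; first exact: index_enum_uniq.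
  by move=> g Ag; rewrite add0r uN.
elim: s c => [|i s IH] c /= us cN.
  have [g Ag] := choice A0.
  by have := cN g Ag; rewrite !big_nil addr0 adde0 lee_fin.
case/andP: us => nis us; rewrite big_cons.
set S := (\sum_(j <- s) _)%E; set M := ereal_sup _.
have step x : A i x -> ((c + u i x)%:E + S <= N%:E)%E.
  move=> Ax; apply: IH => // g Ag.
  have := cN (fun j => if j == i then x else g j).
  rewrite big_cons eqxx addrA.
  rewrite (_ : \sum_(j <- s) _ = \sum_(j <- s) u j (g j)); last first.
    by apply: eq_big_seq => j js; case: eqP nis => // <-; rewrite js.
  by apply=> j; case: eqP => // ->.
have [x0 Ax0] := A0 i; have := step x0 Ax0.
have SNy : S != -oo%E.
  rewrite /S big_tnth; apply/eqP => /esum_eqNyP[j [_ _]].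
  have [x Ax] := A0 (tnth (in_tuple s) j).
  by move/ereal_sup_ninfty/(_ _ (imageP _ Ax)).
case: S SNy step => [r| |] // _ step _.
have : (M <= (N - c - r)%:E)%E.
  apply: ge_ereal_sup => _ [x Ax <-]; have := step x Ax.
  by rewrite -EFinD !lee_fin; lra.
case: M => [M| |]; rewrite ?leNye // -?EFinD ?lee_fin //; lra.
Qed.

(** * Increments as coordinates on the model set *)

Definition trajectory (V : zmodType) (T : nat) (g : 'I_T.+1 -> V) (t : 'I_T.+1) : V :=
  g ord0 - \sum_(s < T.+1 | (0 < s <= t)%N) g s.

Definition increment (V : zmodType) (T : nat) (f : 'I_T.+1 -> V)
    (t : 'I_T.+1) : V :=
  if t == ord0 then f ord0 else f (inord t.-1) - f t.

Lemma trajectory0 (V : zmodType) (T : nat) (g : 'I_T.+1 -> V) :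
  trajectory g ord0 = g ord0.
Proof. by rewrite /trajectory big_pred0 ?subr0 // => s; case: (val s). Qed.

Lemma trajectoryB (V : zmodType) (T : nat) (g : 'I_T.+1 -> V) (s t : 'I_T.+1) :
  t = s.+1 :> nat -> trajectory g s - trajectory g t = g t.
Proof.
move=> ts; rewrite /trajectory [X in _ - (_ - X)](bigD1 t) /=; last by rewrite ts leqnn.
rewrite (_ : \sum_(i < T.+1 | (0 < i <= t)%N && (i != t)) g i =
  \sum_(i < T.+1 | (0 < i <= s)%N) g i); first by rewrite opprB [LHS]addrC subrKA addrK.
apply: eq_bigl => i; rewrite -val_eqE /= ts -andbA; congr (_ && _).
by rewrite andbC -ltn_neqAle ltnS.
Qed.

Lemma incrementS (V : zmodType) (T : nat) (f : 'I_T.+1 -> V) (s t : 'I_T.+1) :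
  t = s.+1 :> nat -> increment f t = f s - f t.
Proof.
move=> ts; rewrite /increment -val_eqE /= ts /=; congr (f _ - _).
by apply: val_inj; rewrite /= inordK.
Qed.

Lemma incrementK (V : zmodType) (T : nat) (f : 'I_T.+1 -> V) :
  trajectory (increment f) = f.
Proof.
apply/funext => -[n nT]; elim: n nT => [|n IH] nT.
  have -> : Ordinal nT = ord0 by exact: val_inj.
  by rewrite trajectory0.
have nT' := ltnW nT.
have e : Ordinal nT = (Ordinal nT').+1 :> nat by [].
have := trajectoryB (increment f) e; rewrite (incrementS f e) IH.
by move/addrI/oppr_inj.
Qed.

Lemma model_trajectory (V : zmodType) (T : nat) (K : 'I_T.+1 -> set V)
    (g : 'I_T.+1 -> V) :
  (forall s, K s (g s)) -> model_set K (trajectory g).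
Proof.
by move=> Kg; split=> [|s t ts]; rewrite ?trajectory0 ?(trajectoryB g ts).
Qed.

Lemma model_increment (V : zmodType) (T : nat) (K : 'I_T.+1 -> set V)
    (f : 'I_T.+1 -> V) :
  model_set K f -> forall s, K s (increment f s).
Proof.
move=> [K0 KS] s; rewrite /increment; case: eqVneq => [->//|].
rewrite -val_eqE /= -lt0n => s0; apply: KS.
by rewrite inordK prednK // ltnW.
Qed.

(** * The error of a linear recovery *)

(** The functionals inside the suprema of the objective, gathered in one family
indexed by time. *)
Definition residual (R : realType) (V : lmodType R) (T : nat)
    (m : 'I_T.+1 -> nat) (lambda : forall t, 'I_(m t) -> {scalar V})
    (Q : {scalar V}) (a : data R m) (s : 'I_T.+1) (g : V) : R :=
  if s == ord0 then Q g - tail_functional lambda a ord0 g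
  else tail_functional lambda a s g.

Lemma objectiveE (R : realType) (V : lmodType R) (T : nat)
    (K : 'I_T.+1 -> set V) (m : 'I_T.+1 -> nat)
    (lambda : forall t, 'I_(m t) -> {scalar V}) (Q : {scalar V})
    (a : data R m) :
  objective K lambda Q a =
  (\sum_s ereal_sup [set (`|residual lambda Q a s g|)%:E | g in K s])%E.
Proof.
rewrite (bigD1 ord0) //=; congr (_ + _)%E.
apply: eq_big => [s|s s0]; first by rewrite lt0n.
by congr ereal_sup; apply: eq_imagel => g _;
  rewrite /residual -val_eqE /= -[_ == _]negbK -lt0n s0.
Qed.

Lemma linear_recoveryE (R : realType) (V : lmodType R) (T : nat)
    (m : 'I_T.+1 -> nat) (lambda : forall t, 'I_(m t) -> {scalar V})
    (a : data R m) (f : 'I_T.+1 -> V) :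
  linear_recovery a (observe lambda f) =
  \sum_t \sum_(i < m t) entry a i * lambda t i (f t).
Proof.
rewrite [RHS](bigD1 ord0) //= /linear_recovery.
have E t (i : 'I_(m t)) : entry (observe lambda f) i = lambda t i (f t).
  by rewrite /entry /observe mxcolK mxE.
congr (_ + _); first by apply: eq_bigr => i _; rewrite E.
by apply: eq_big => [s|s s0]; [rewrite lt0n | apply: eq_bigr => i _; rewrite E].
Qed.

(** Summation by parts: the observed functionals at time t act on g_0 minus the g_s
with 0 < s <= t, so g_s collects the functionals of all times t >= s. *)
Lemma error_trajectory (R : realType) (V : lmodType R) (T : nat)
    (m : 'I_T.+1 -> nat) (lambda : forall t, 'I_(m t) -> {scalar V})
    (Q : {scalar V}) (a : data R m) (g : 'I_T.+1 -> V) :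
  Q (trajectory g ord0) - linear_recovery a (observe lambda (trajectory g)) =
  \sum_s residual lambda Q a s (g s).
Proof.
rewrite trajectory0 linear_recoveryE [RHS](bigD1 ord0) //= {1}/residual eqxx -addrA.
congr (_ + _).
under eq_bigr => t _ do under eq_bigr => i _ do
  rewrite /trajectory raddfB raddf_sum mulrBr mulr_sumr.
under eq_bigr do rewrite sumrB.
rewrite sumrB opprB addrC; congr (_ + _).
transitivity (\sum_(t < T.+1) \sum_(s < T.+1 | (0 < s <= t)%N)
    \sum_(i < m t) entry a i * lambda t i (g s)).
  by apply: eq_bigr => t _; rewrite exchange_big.
rewrite (exchange_big_dep (fun s : 'I_T.+1 => s != ord0)) /=; last first.
  by move=> t s _ /andP[s0 _]; rewrite -lt0n.
apply: eq_bigr => s s0; rewrite /residual (negbTE s0) /tail_functional.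
by apply: eq_bigl => t; rewrite lt0n s0.
Qed.

Lemma residualN (R : realType) (V : lmodType R) (T : nat)
    (m : 'I_T.+1 -> nat) (lambda : forall t, 'I_(m t) -> {scalar V})
    (Q : {scalar V}) (a : data R m) (s : 'I_T.+1) (g : V) :
  residual lambda Q a s (- g) = - residual lambda Q a s g.
Proof.
have tN r : tail_functional lambda a r (- g) = - tail_functional lambda a r g.
  rewrite /tail_functional -sumrN; apply: eq_bigr => t _.
  by rewrite -sumrN; apply: eq_bigr => i _; rewrite raddfN mulrN.
by rewrite /residual !tN raddfN; case: ifP => // _; rewrite opprD.
Qed.

Lemma symmetric_convex0 (R : realType) (V : lmodType R) (A : set V) :
  symmetric_set A -> convex_set A -> A !=set0 -> A 0.
Proof.
move=> sA /convex_setP cA [x Ax].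
have half : 1 - 2^-1 = 2^-1 :> R by field.
by have := cA x (- x) 2^-1; rewrite half scalerN subrr; apply; [lra|lra|exact: Ax|exact: sA].
Qed.

Lemma symmetric_model (V : zmodType) (T : nat) (K : 'I_T.+1 -> set V) :
  (forall t, symmetric_set (K t)) -> symmetric_set (model_set K).
Proof.
move=> sK f [K0 KS]; split=> [|s t /KS]; first exact: sK.
by move/sK; rewrite opprB opprK addrC.
Qed.

Lemma convex_model (R : realType) (V : lmodType R) (T : nat)
    (K : 'I_T.+1 -> set V) :
  (forall t, convex_set (K t)) -> convex_set (model_set K).
Proof.
move=> cK; have {}cK t := (convex_setP (K t)).1 (cK t).
apply/convex_setP => f h a a0 a1 [f0 fS] [h0 hS].
split=> [|s t ts]; first exact: cK.
have := cK _ _ _ _ a0 a1 (fS _ _ ts) (hS _ _ ts).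
by rewrite !scalerBr addrACA -opprD.
Qed.

Lemma gwce_le_objective (R : realType) (V : lmodType R) (T : nat)
    (K : 'I_T.+1 -> set V) (m : 'I_T.+1 -> nat)
    (lambda : forall t, 'I_(m t) -> {scalar V}) (Q : {scalar V})
    (a : data R m) :
  (gwce K lambda Q (linear_recovery a) <= objective K lambda Q a)%E.
Proof.
rewrite objectiveE; apply: ge_ereal_sup => _ [f Kf <-].
rewrite -(incrementK f) error_trajectory.
apply: (@le_trans _ _ (\sum_s `|residual lambda Q a s (increment f s)|)%:E).
  by rewrite lee_fin ler_norm_sum.
rewrite -sumEFin; apply: lee_sum => s _; apply: ereal_sup_ubound.
by exists (increment f s) => //; exact: model_increment.
Qed.

(** A bound on the signed error suffices: flipping the sign of each increment
separately stays inside the product of the K t and makes all the residuals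
nonnegative. *)
Lemma objective_le (R : realType) (V : lmodType R) (T : nat)
    (K : 'I_T.+1 -> set V) (m : 'I_T.+1 -> nat)
    (lambda : forall t, 'I_(m t) -> {scalar V}) (Q : {scalar V})
    (a : data R m) (N : R) :
  (forall t, symmetric_set (K t)) -> (forall t, K t !=set0) ->
  (forall f, model_set K f ->
     Q (f ord0) - linear_recovery a (observe lambda f) <= N) ->
  (objective K lambda Q a <= N%:E)%E.
Proof.
move=> sK K0 QN; rewrite objectiveE; apply: sum_ereal_sup_le => // g Kg.
pose h s := if 0 <= residual lambda Q a s (g s) then g s else - g s.
have Kh s : K s (h s) by rewrite /h; case: ifP => // _; exact: sK.
have := QN _ (model_trajectory Kh); rewrite error_trajectory; congr (_ <= _).
apply: eq_bigr => s _; rewrite /h; case: ifPn => [/ger0_norm //|].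
by rewrite -ltNge residualN => /ltr0_norm.
Qed.

(** * The null error *)

Definition null_error (R : realType) (V : lmodType R) (T : nat)
    (K : 'I_T.+1 -> set V) (m : 'I_T.+1 -> nat)
    (lambda : forall t, 'I_(m t) -> {scalar V}) (Q : {scalar V}) : \bar R :=
  ereal_sup [set (`|Q (f ord0)|)%:E
    | f in [set f | model_set K f /\ observe lambda f = 0]].

(** Q (f ord0) is half the difference of the errors of Delta at f and at - f, at
which Delta sees the same data 0. *)
Lemma null_error_le_gwce (R : realType) (V : lmodType R) (T : nat)
    (K : 'I_T.+1 -> set V) (m : 'I_T.+1 -> nat)
    (lambda : forall t, 'I_(m t) -> {scalar V}) (Q : {scalar V})
    (Delta : data R m -> R) :
  (forall t, symmetric_set (K t)) ->
  (null_error K lambda Q <= gwce K lambda Q Delta)%E.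
Proof.
move=> sK; apply: ge_ereal_sup => _ [f [Kf f0] <-].
have fN0 : observe lambda (- f) = 0.
  rewrite -oppr0 -f0; apply/matrixP => i j; rewrite !mxE.
  by rewrite raddfN.
have KN := symmetric_model sK Kf.
have Le h : model_set K h -> observe lambda h = 0 ->
    ((`|Q (h ord0) - Delta 0|)%:E <= gwce K lambda Q Delta)%E.
  by move=> Kh h0; apply: ereal_sup_ubound; exists h => //; rewrite h0.
have := Le f Kf f0; have := Le _ KN fN0.
case: gwce => [w| |]; rewrite ?leey // !lee_fin raddfN => wN wP.
have -> : Q (f ord0) = ((Q (f ord0) - Delta 0) - (- Q (f ord0) - Delta 0)) / 2.
  by field.
rewrite normrM [`|2^-1|]ger0_norm ?invr_ge0 // ler_pdivrMr //.
by apply: (le_trans (ler_normB _ _)); lra.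
Qed.

(** Smolyak's theorem for this model: an infinite null error makes any a suitable;
a finite one is the supremum N of Q (f ord0) over the model set under the constraint
of zero data, and the Lagrange multipliers of the constraints are the entries of a. *)
Lemma null_error_attained (R : realType) (V : lmodType R) (T : nat)
    (K : 'I_T.+1 -> set V) (m : 'I_T.+1 -> nat)
    (lambda : forall t, 'I_(m t) -> {scalar V}) (Q : {scalar V}) :
  (forall t, symmetric_set (K t)) -> (forall t, convex_set (K t)) ->
  (forall t, K t !=set0) ->
  exists a : data R m, (objective K lambda Q a <= null_error K lambda Q)%E.
Proof.
move=> sK cK K0.
have mem0 : [set f | model_set K f /\ observe lambda f = 0] 0.
  split; last by apply/matrixP => i j; rewrite !mxE raddf0.
  have z t : K t 0 by exact: symmetric_convex0.
  by split=> [|s t _] /=; rewrite ?subr0; exact: z.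
have := ereal_sup_ubound (imageP (fun f => (`|Q (f ord0)|)%:E) mem0).
rewrite -/(null_error K lambda Q).
case E: (null_error K lambda Q) => [N| |] // _; last by exists 0; rewrite leey.
pose l (p : {t : 'I_T.+1 & 'I_(m t)}) (f : 'I_T.+1 -> V) :=
  lambda (tag p) (tagged p) (f (tag p)).
have lq : scalar (fun f : 'I_T.+1 -> V => Q (f ord0)).
  by move=> c u v; rewrite /= linearP.
have ll p : scalar (l p) by move=> c u v; rewrite /l /= linearP.
have [|c cN] := @lagrange_multipliers R ('I_T.+1 -> V) _ (index_enum {t : 'I_T.+1 & 'I_(m t)})
  (model_set K) _ l N (index_enum_uniq _) (symmetric_model sK) (convex_model cK) lq ll.
  move=> f Kf lf; rewrite -lee_fin -E; apply: (@le_trans _ _ (`|Q (f ord0)|)%:E).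
    by rewrite lee_fin ler_norm.
  apply: ereal_sup_ubound; exists f => //; split=> //.
  apply/colP => k; rewrite !mxE.
  exact: (lf (Tagged (fun t => 'I_(m t)) _) (mem_index_enum _)).
exists (\mxcol_t \col_i c (Tagged (fun t => 'I_(m t)) i)).
apply: objective_le => // f Kf; rewrite linear_recoveryE sig_big_dep /=.
apply: le_trans (cN f Kf); rewrite lerD2l lerN2 le_eqVlt; apply/orP; left.
apply/eqP/eq_bigr => -[t i] _.
by rewrite /entry mxcolK mxE.
Qed.

Lemma objective_empty (R : realType) (V : lmodType R) (T : nat)
    (K : 'I_T.+1 -> set V) (m : 'I_T.+1 -> nat)
    (lambda : forall t, 'I_(m t) -> {scalar V}) (Q : {scalar V})
    (a : data R m) (t : 'I_T.+1) :
  K t = set0 -> objective K lambda Q a = -oo%E.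
Proof.
move=> Kt; rewrite objectiveE; apply/esum_eqNyP; exists t.
by rewrite mem_index_enum Kt image_set0 ereal_sup0.
Qed.

(** * Optimality *)

Theorem theorem1 (R : realType) (F : completeNormedModType R) (T : nat)
    (hT : (1 <= T)%N)
    (K : 'I_T.+1 -> set F)
    (Ksym : forall t, symmetric_set (K t))
    (Kconv : forall t, convex_set (K t))
    (m : 'I_T.+1 -> nat)
    (lambda : forall t : 'I_T.+1, 'I_(m t) -> {scalar F})
    (Q : {scalar F}) :
  (exists a : data R m, solution K lambda Q a) /\
  (forall a : data R m, solution K lambda Q a ->
     globally_optimal K lambda Q (linear_recovery a)).
Proof.
have [K0|/existsNP[t /set0P/negP/negPn/eqP Kt]] :=
    pselect (forall t, K t !=set0); last first.
  have oNy a := @objective_empty R F T K m lambda Q a t Kt.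
  split=> [|a _ Delta]; first by exists 0 => b; rewrite oNy leNye.
  by rewrite (le_trans (gwce_le_objective K lambda Q a)) // oNy leNye.
have [a aN] := null_error_attained lambda Q Ksym Kconv K0.
split=> [|b sol Delta].
  exists a => b; apply: (le_trans aN).
  exact: le_trans (null_error_le_gwce _ _ _ Ksym) (gwce_le_objective K lambda Q b).
apply: (le_trans (gwce_le_objective K lambda Q b)).
apply: (le_trans (sol a)); apply: (le_trans aN).
exact: null_error_le_gwce.
Qed.
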